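(* Let $\sigma(x)=2\Phi(x)-1$ be the probit activation. Then for all $\mu_1\in\mathbb R$ and all positive semidefinite $\begin{pmatrix}\nu_{11}&\nu_{12}\\ \nu_{12}&\nu_{22}\end{pmatrix}$, $$L_\sigma(\mu_1;\nu_{11},\nu_{22},\nu_{12})=\frac{2\,\nu_{12}}{\sqrt{1+\nu_{11}}}\,\phi\!\left(\frac{\mu_1}{\sqrt{1+\nu_{11}}}\right).$$
   Context: $\Phi$ and $\phi=\Phi'$ are the standard normal CDF and density. $L_\sigma(\mu_1;\nu_{11},\nu_{22},\nu_{12}):=\operatorname{Cov}(\sigma(X_1),X_2)$ where $(X_1,X_2)$ is jointly normal with covariance matrix $\begin{pmatrix}\nu_{11}&\nu_{12}\\ \nu_{12}&\nu_{22}\end{pmatrix}$, $\mathbb E X_1=\mu_1$, and $\mathbb E X_2$ arbitrary (the value does not depend on it). *)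

(* Defs.v *)
From HB Require Import structures.
From mathcomp Require Export all_boot all_order all_algebra.
From mathcomp Require Export all_classical all_reals all_analysis.

Set Implicit Arguments.
Unset Strict Implicit.
Unset Printing Implicit Defensive.

Import Order.TTheory GRing.Theory Num.Theory.
Local Open Scope classical_set_scope.
Local Open Scope ring_scope.

Definition psdmx (R : realType) (n : nat) (S : 'M[R]_n) : Prop :=
  S^T = S /\ forall u : 'rV[R]_n, 0 <= (u *m S *m u^T) 0 0.

Definition covmx2 (R : realType) (nu11 nu22 nu12 : R) : 'M[R]_2 :=
  \matrix_(i, j) if i != j then nu12 else if i == 0 then nu11 else nu22.

(* N(m, v), parametrised by the variance [v].  The library's [normal_prob m s]
   takes the standard deviation, and for [s = 0] it is the uniform law on
   [0, 1]; here N(m, 0) is the Dirac mass at [m]. *)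
Definition normal_law (R : realType) (m v : R) (A : set R) : \bar R :=
  if v == 0 then \d_m A else normal_prob m (Num.sqrt v) A.

Definition is_normal d (T : measurableType d) (R : realType)
    (P : probability T R) (X : T -> R) : Prop :=
  exists m v : R, 0 <= v /\
    forall A : set R, measurable A -> P (X @^-1` A) = normal_law m v A.

(* Degenerate laws are allowed, so that the covariance matrix may be
   singular. *)
Definition jointly_normal d (T : measurableType d) (R : realType)
    (P : probability T R) (X1 X2 : {RV P >-> R}) : Prop :=
  forall a b : R, is_normal P (fun w => a * X1 w + b * X2 w).

Definition std_normal_cdf (R : realType) (x : R) : R :=
  fine (normal_prob (0 : R) 1 `]-oo, x]).

Definition std_normal_pdf (R : realType) (x : R) : R := normal_pdf 0 1 x.

Definition probit (R : realType) (x : R) : R := 2 * std_normal_cdf x - 1.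

(* Main.v *)
(** Stein's argument: for a bounded smooth [f] and jointly normal [X1], [X2],
    [Cov (f X1, X2) = Cov (X1, X2) E f'(X1)].  Joint normality only gives the
    laws of the linear combinations of [X1] and [X2], so the joint density is
    avoided.  Write [X2 = c X1 + Y] with [c = nu12 / nu11], so that [Y] is
    uncorrelated with [X1].  If [G' = f], then [G (X1 + b (Y - E Y))] and
    [G (X1 - b (Y - E Y))] have the same expectation, because their arguments
    are normal with the same mean and variance; differentiating at [b = 0]
    gives [Cov (f X1, Y) = 0].  The remaining term [c Cov (f X1, X1)] is a
    one-dimensional integration by parts.  For the probit function, [f' = 2 phi]
    and [G x = x f x + 2 phi x], and [E phi (X1)] is obtained by completing the
    square. *)

From HB Require Import structures.
Require Import Defs.
From mathcomp Require Import all_boot all_order all_algebra.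
From mathcomp Require Import all_classical all_reals all_analysis measurable_realfun.
From mathcomp Require Import ring lra.

Set Implicit Arguments.
Unset Strict Implicit.
Unset Printing Implicit Defensive.

Import Order.TTheory GRing.Theory Num.Theory.
Import numFieldTopology.Exports numFieldNormedType.Exports.
Local Open Scope classical_set_scope.
Local Open Scope ring_scope.

(** * Integration against a measure given by a density *)

Section density.
Local Open Scope ereal_scope.
Context d (T : measurableType d) (R : realType).
Variables (mu nu : {measure set T -> \bar R}) (p : T -> R).
Hypothesis mp : measurable_fun setT p.
Hypothesis p0 : forall x, (0 <= p x)%R.
Hypothesis nuE : forall A, measurable A -> nu A = \int[mu]_(x in A) (p x)%:E.

Import HBNNSimple.

Let integral_density_nnsfun (f : {nnsfun T >-> R}) :
  \int[nu]_x (f x)%:E = \int[mu]_x ((f x)%:E * (p x)%:E).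
Proof.
under [LHS]eq_integral do rewrite fimfunE -fsumEFin//.
rewrite [LHS]ge0_integral_fsum//; last 2 first.
  - by move=> r; exact/measurable_EFinP/measurableT_comp.
  - by move=> n x _; rewrite EFinM nnfun_muleindic_ge0.
under [RHS]eq_integral.
  move=> x xD; rewrite fimfunE -fsumEFin// muleC ge0_mule_fsumr; last first.
    by move=> r; rewrite EFinM nnfun_muleindic_ge0.
  over.
rewrite [RHS]ge0_integral_fsum//; last 2 first.
  - move=> r; apply/measurable_EFinP/measurable_funM => //.
    exact/measurableT_comp.
  - move=> n x _; rewrite EFinM.
    by apply: mule_ge0; [rewrite lee_fin|exact: nnfun_muleindic_ge0].
apply: eq_fsbigr => r _; rewrite integralZl_indic_nnsfun//= integral_indic// setIT.
have mA : measurable (f @^-1` [set r]) by exact: measurable_sfunP.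
rewrite nuE//.
under [RHS]eq_integral do rewrite EFinM muleCA -[(p _)%:E * _]muleC.
have [r0|r0] := leP 0%R r.
  rewrite ge0_integralZl//; last 2 first.
  - apply/measurable_EFinP/measurable_funM => //.
  - by move=> x _; rewrite mule_ge0 ?lee_fin.
  congr *%E; rewrite integral_mkcond; apply: eq_integral => x _.
  rewrite patchE indicE; case: ifPn => xA; first by rewrite mul1e.
  by rewrite mul0e.
(* A nonnegative simple function never takes the negative value [r], so this level contributes 0 to
   both sides. *)
have -> : f @^-1` [set r] = set0.
  by apply/seteqP; split => // x /= fxr; move: r0; rewrite -fxr ltNge fun_ge0.
rewrite integral_set0 mule0 integral0_eq// => x _.
by rewrite indicE in_set0 mul0e mule0.
Qed.

(** Monotone convergence on both sides, along simple functions increasing to [f]; the nonnegative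
    factor [p] keeps the products increasing. *)
Lemma ge0_integral_density (f : T -> \bar R) : measurable_fun setT f ->
  (forall x, 0 <= f x) -> \int[nu]_x f x = \int[mu]_x (f x * (p x)%:E).
Proof.
move=> mf f0; pose f_ := nnsfun_approx measurableT mf.
have cvf x : (f_ n x)%:E @[n --> \oo] --> f x by exact: cvg_nnsfun_approx.
transitivity (lim (\int[nu]_x (f_ n x)%:E @[n --> \oo])).
  rewrite -monotone_convergence//=.
  - by apply: eq_integral => x _; apply/esym/cvg_lim.
  - by move=> n; exact/measurable_EFinP/measurable_funTS.
  - by move=> n ? _; rewrite lee_fin.
  - by move=> ? _ ? ? mn; rewrite lee_fin; exact/lefP/nd_nnsfun_approx.
transitivity (lim (\int[mu]_x ((f_ n x)%:E * (p x)%:E) @[n --> \oo])).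
  by apply: congr_lim; apply/funext => n /=; exact: integral_density_nnsfun.
rewrite -monotone_convergence//=.
- by apply: eq_integral => x _; apply/cvg_lim => //; apply: cvgeZr.
- by move=> n; exact/measurable_EFinP/measurable_funM.
- by move=> n ? _; rewrite mule_ge0 ?lee_fin.
- move=> x _ ? ? mn; rewrite lee_wpmul2r ?lee_fin//.
  exact/lefP/nd_nnsfun_approx.
Qed.

(** Multiplication by the nonnegative [p] commutes with taking positive and negative parts, which
    reduces the claim to nonnegative functions. *)
Lemma integral_density (f : T -> R) : measurable_fun setT f ->
  \int[nu]_x (f x)%:E = \int[mu]_x (f x * p x)%:E.
Proof.
move=> mf; have mEf : measurable_fun setT (EFin \o f) by exact/measurable_EFinP.
rewrite integralE [RHS]integralE !ge0_integral_density//.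
- congr (_ - _); apply: eq_integral => x _;
  rewrite (funeposE, funenegE) (funeposE, funenegE) -?EFinN -!EFin_max -EFinM;
  by rewrite maxr_pMl// mul0r// mulNr.
- exact: measurable_funeneg.
- exact: measurable_funepos.
Qed.

Lemma integrable_density (f : T -> R) : measurable_fun setT f ->
  nu.-integrable setT (EFin \o f) <->
  mu.-integrable setT (fun x => (f x * p x)%:E).
Proof.
move=> mf; have E : \int[nu]_x `|(f x)%:E| = \int[mu]_x `|(f x * p x)%:E|.
  rewrite ge0_integral_density//; last first.
    by apply/measurable_EFinP; exact: measurableT_comp.
  apply: eq_integral => x _.
  by rewrite EFinM abseM (gee0_abs (x := (p x)%:E)) ?lee_fin.
by split => /integrableP[_ H]; apply/integrableP; split; rewrite ?E// -?E//;
  apply/measurable_EFinP => //; exact: measurable_funM.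
Qed.

End density.

(** * Reduction of normal laws to the standard Gaussian measure *)

Section standardization.
Context (R : realType).
Local Notation mu := (@lebesgue_measure R).
Local Notation gauss := (normal_prob (0 : R) 1).

(** The factor [s] on the left is the Jacobian of the substitution x = m + s z. *)
Lemma normal_pdf_affine (m s z : R) : (0 < s)%R ->
  (normal_pdf m s (m + s * z) * s = normal_pdf 0 1 z)%R.
Proof.
move=> s0; rewrite !normal_pdfE ?gt_eqF// /normal_peak /normal_fun.
have -> : (- (m + s * z - m) ^+ 2 / (s ^+ 2 *+ 2) =
    - (z - 0) ^+ 2 / (1 ^+ 2 *+ 2))%R.
  by rewrite addrC addKr subr0 expr1n; field; rewrite gt_eqF.
rewrite expr1n mul1r -mulrnAr sqrtrM ?sqr_ge0// sqrtr_sqr gtr0_norm//.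
rewrite invfM mulrAC -(mulrA s^-1) (mulrC _ s) mulrA mulVf ?gt_eqF//.
by rewrite mul1r.
Qed.

Lemma integral_normal_prob (m s : R) (f : R -> R) : measurable_fun setT f ->
  (\int[normal_prob m s]_x (f x)%:E = \int[mu]_x (f x * normal_pdf m s x)%:E)%E.
Proof.
move=> mf; apply: integral_density => //; first exact: measurable_normal_pdf.
exact: normal_pdf_ge0.
Qed.

(** Substitution x = m + s z on the whole line. The substitution theorem asks for a nonnegative
    integrand; signed functions are treated below through their positive and negative parts. *)
Lemma ge0_integral_normal_prob_affine (m s : R) (f : R -> R) : (0 < s)%R ->
  continuous f -> (forall x, 0 <= f x)%R ->
  (\int[normal_prob m s]_x (f x)%:E = \int[gauss]_z (f (m + s * z)%R)%:E)%E.
Proof.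
move=> s0 cf f0; have cF : continuous (fun z => m + s * z)%R.
  by move=> z; apply: cvgD; [exact: cvg_cst|apply: cvgMr; exact: cvg_id].
have mf : measurable_fun setT f by exact: continuous_measurable_fun.
have mF : measurable_fun setT (fun z => f (m + s * z)%R).
  apply: continuous_measurable_fun => z.
  by apply: (@continuous_comp _ _ _ (fun z => m + s * z)%R f); [exact: cF|exact: cf].
rewrite (integral_normal_prob m s mf) (integral_normal_prob 0 1 mF).
have dF (x : R) : is_derive x (1 : R) (fun z => m + s * z)%R s.
  by apply: is_derive_eq; rewrite /GRing.scale/= add0r mul1r mulr1.
have F'E : (fun z : R => m + s * z)%R^`()%classic = cst s.
  by apply/funext => x; rewrite derive1E; exact: (@derive_val _ _ _ _ _ _ _ (dF x)).
rewrite (@increasing_ge0_integration_by_substitutionT _ (fun z => m + s * z)%R).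
- apply: eq_integral => z _.
  by rewrite F'E /= !fctE -mulrA normal_pdf_affine.
- by move=> x y xy; rewrite ltrD2l ltr_pM2l.
- by rewrite F'E => ?; exact: cvg_cst.
- by rewrite F'E; exact: is_cvg_cst.
- by rewrite F'E; exact: is_cvg_cst.
- by move=> x; exact: (@ex_derive _ _ _ _ _ _ _ (dF x)).
- rewrite [X in X @ _](_ : _ = (fun z => z + m) \o (fun z => z * s)).
    by apply: cvg_comp (cvg_addrr_Ny m); exact: gt0_cvgMlNy cvg_id.
  by apply/funext => z /=; rewrite addrC mulrC.
- rewrite [X in X @ _](_ : _ = (fun z => z + m) \o (fun z => z * s)).
    by apply: cvg_comp (cvg_addrr m); exact: gt0_cvgMly cvg_id.
  by apply/funext => z /=; rewrite addrC mulrC.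
- move=> x; apply: cvgM; first exact: cf.
  by apply: continuous_normal_pdf; rewrite gt_eqF.
- by move=> x; rewrite mulr_ge0// normal_pdf_ge0.
Qed.

Lemma continuous_max0 (f : R -> R) : continuous f ->
  continuous (fun x => Num.max (f x) 0).
Proof.
move=> cf x; apply: (@continuous_comp _ _ _ (fun x => (f x, 0))
  (fun p : R * R => Num.max p.1 p.2)); last exact: max_continuous.
exact: (cvg_pair (cf x) (cvg_cst _)).
Qed.

Context d (T : measurableType d) (P : probability T R).

Lemma ge0_integral_normal_law (X : {RV P >-> R}) (m v : R) (f : R -> R) :
  (0 <= v)%R ->
  (forall A : set R, measurable A -> P (X @^-1` A) = normal_law m v A) ->
  continuous f -> (forall x, 0 <= f x)%R ->
  (\int[P]_w (f (X w))%:E = \int[gauss]_z (f (m + Num.sqrt v * z)%R)%:E)%E.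
Proof.
move=> v0 lawX cf f0.
have mf : measurable_fun setT (EFin \o f).
  by apply/measurable_EFinP; exact: continuous_measurable_fun.
(* [normal_prob] is a measure on [measurableTypeR R], which has the same
   measurable sets as [R] but another display. *)
have mX : measurable_fun setT (X : T -> measurableTypeR R).
  exact: measurable_funPT X.
pose Y : {RV P >-> measurableTypeR R} :=
  HB.pack_for {mfun T >-> measurableTypeR R} (X : T -> measurableTypeR R)
    (isMeasurableFun.Build _ _ _ _ _ mX).
transitivity (\int[distribution P Y]_x (f x)%:E)%E.
  by rewrite ge0_integral_distribution// => y; rewrite lee_fin.
(* For [v = 0] the law is the Dirac mass at [m], and the right-hand side is the integral of the
   constant [f m] against a probability, so one formula covers both cases. *)
have [v_eq0|vN0] := eqVneq v 0%R.
  rewrite (eq_measure_integral (@dirac _ (measurableTypeR R) m R)); last first.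
    by move=> A mA _; rewrite [LHS]lawX// /normal_law v_eq0 eqxx.
  rewrite integral_dirac// diracT mul1e v_eq0 sqrtr0.
  under eq_integral do rewrite mul0r addr0.
  by rewrite integral_cst//= [X in (_ * X)%E]probability_setT mule1.
have s0 : (0 < Num.sqrt v)%R by rewrite sqrtr_gt0 lt_neqAle eq_sym vN0.
rewrite -ge0_integral_normal_prob_affine//.
rewrite (eq_measure_integral (normal_prob m (Num.sqrt v)))// => A mA _.
by rewrite [LHS]lawX// /normal_law (negbTE vN0).
Qed.

Lemma integral_normal_law (X : {RV P >-> R}) (m v : R) (f : R -> R) :
  (0 <= v)%R ->
  (forall A : set R, measurable A -> P (X @^-1` A) = normal_law m v A) ->
  continuous f ->
  (\int[P]_w (f (X w))%:E = \int[gauss]_z (f (m + Num.sqrt v * z)%R)%:E)%E.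
Proof.
move=> v0 lawX cf; rewrite integralE [RHS]integralE; congr (_ - _)%E.
- rewrite -[LHS](@eq_integral _ _ _ P _ _ (fun w => (Num.max (f (X w)) 0)%:E)).
    rewrite (ge0_integral_normal_law v0 lawX (f := fun x => Num.max (f x) 0))//.
    + by apply: eq_integral => z _; rewrite funeposE -EFin_max.
    + by apply: continuous_max0.
    + by move=> x; rewrite le_max lexx orbT.
  by move=> x _; rewrite funeposE -EFin_max.
- rewrite -[LHS](@eq_integral _ _ _ P _ _ (fun w => (Num.max (- f (X w)) 0)%:E)).
    rewrite (ge0_integral_normal_law v0 lawX (f := fun x => Num.max (- f x) 0))//.
    + by apply: eq_integral => z _; rewrite funenegE -EFinN -EFin_max.
    + by apply: continuous_max0 => x; apply: cvgN; exact: cf.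
    + by move=> x; rewrite le_max lexx orbT.
  by move=> x _; rewrite funenegE -EFinN -EFin_max.
Qed.

End standardization.

(** * Integrating a derivative over the real line *)

Lemma is_derive_continuous (R : realType) (f f' : R -> R) :
  (forall x, is_derive x (1 : R) f (f' x)) -> continuous f.
Proof.
move=> df x; apply/differentiable_continuous/derivable1_diffP.
exact: ex_derive.
Qed.

(** On [-(n+1), n+1] the fundamental theorem of calculus leaves only boundary terms, which tend to
    0; dominated convergence with majorant |f| passes to the whole line. *)
Lemma integral_derive_eq0 (R : realType) (F f : R -> R) :
  (forall x, is_derive x (1 : R) F (f x)) -> continuous f ->
  (@lebesgue_measure R).-integrable setT (EFin \o f) ->
  F n%:R @[n --> \oo] --> (0 : R) -> F (- n%:R) @[n --> \oo] --> (0 : R) ->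
  (\int[@lebesgue_measure R]_x (f x)%:E = 0)%E.
Proof.
move=> dF cf intf Fy FNy; set mu := @lebesgue_measure R.
have mf : measurable_fun [set: R] f by exact: continuous_measurable_fun.
(* The index n+1 keeps the interval nondegenerate at n = 0, as the fundamental theorem requires. *)
pose I (n : nat) : set R := `[(- n.+1%:R)%R, n.+1%:R%R]%classic.
have mI n : measurable (I n) by exact: measurable_itv.
pose fn (n : nat) : R -> \bar R := (EFin \o f) \_ (I n).
have mfn n : measurable_fun [set: R] (fn n).
  apply/(measurable_restrictT _ _).1 => //.
  by apply: measurable_funTS; exact/measurable_EFinP.
have fn_cvg x : fn n x @[n --> \oo] --> (f x)%:E.
  apply: cvg_near_cst; near=> n.
  rewrite /fn patchE mem_set// /I /= in_itv/= -ler_norml.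
  near: n; exists (Num.trunc `|x|) => // n /= xn.
  by apply/ltW/(lt_le_trans (truncnS_gt _)); rewrite ler_nat.
have fn_le x n : (`|fn n x| <= `|(f x)%:E|)%E.
  by rewrite /fn patchE; case: ifPn => // _; rewrite abse0 abse_ge0.
have [_ _] : [/\ mu.-integrable setT (EFin \o f),
   [sequence \int[mu]_x `|fn n x - (EFin \o f) x|]_n @ \oo --> 0 &
   [sequence \int[mu]_x (fn n x)]_n @ \oo --> \int[mu]_x ((EFin \o f) x)]%E.
  apply: (@dominated_convergence _ _ _ mu setT measurableT fn (EFin \o f)
    (fun x => `|(f x)%:E|%E)) => //.
  - exact/measurable_EFinP.
  - by apply: aeW => x _; exact: fn_cvg.
  - exact: integrable_abse.
  - by apply: aeW => x n _; exact: fn_le.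
move=> /cvg_lim <-//; apply/cvg_lim => //.
have cF : continuous F by exact: is_derive_continuous dF.
have E n : (\int[mu]_x (fn n x) = (F n.+1%:R - F (- n.+1%:R))%:E)%E.
  rewrite -integral_mkcond EFinB.
  apply: (continuous_FTC2 (F := F)).
  - by apply: (@lt_trans _ _ 0); rewrite ?oppr_lt0 ltr0n.
  - exact: continuous_subspaceT.
  - split.
    + by move=> x _; apply: ex_derive.
    + by apply: cvg_at_right_filter; exact: cF.
    + by apply: cvg_at_left_filter; exact: cF.
  - by move=> x _; rewrite derive1E; apply: derive_val.
rewrite [X in X @ _ --> _](_ : _ =
    (fun n => (F n.+1%:R - F (- n.+1%:R))%:E)); last first.
  by apply/funext => n; exact: E.
apply: cvg_EFin; first by exact: nearW.
rewrite [X in X @ _ --> _](_ : _ = (fun n => F n.+1%:R - F (- n.+1%:R)))//.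
rewrite -[X in _ --> X](subrr (0 : R)).
apply: cvgB; first by rewrite (cvg_shiftS (fun n => F n%:R)).
by rewrite (cvg_shiftS (fun n => F (- n%:R))).
Unshelve. all: by end_near. Qed.

(** * The standard Gaussian measure: tails, integrability and Stein's identity *)

Section gauss.
Context (R : realType).
Local Notation mu := (@lebesgue_measure R).
Local Notation gauss := (normal_prob (0 : R) 1).
Local Notation phi := (normal_pdf (0 : R) 1).

Lemma std_normal_pdfE (x : R) : phi x = normal_peak 1 * expR (- (x ^+ 2 / 2)).
Proof.
rewrite normal_pdfE ?oner_eq0// /normal_fun subr0 expr1n mulNr.
by congr (_ * expR (- (_ / _))).
Qed.

Lemma is_derive_std_normal_pdf (x : R) :
  is_derive x (1 : R) phi (- (x * phi x)).
Proof.
have -> : phi = (fun x : R => normal_peak 1 * expR (- (x ^+ 2 / 2))).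
  by apply/funext => y; exact: std_normal_pdfE.
by apply: is_derive_eq; rewrite /GRing.scale/= ?mulr0 ?add0r; field.
Qed.

(** From e^t >= 1 + t at t = x^2 / 2, one gets 1 + x^2 <= 2 e^t. This yields the decay of boundary
    terms at infinity. *)
Lemma std_normal_pdf_sqr_ub (x : R) : (1 + x ^+ 2) * phi x <= 2 * normal_peak 1.
Proof.
rewrite std_normal_pdfE mulrCA mulrC ler_wpM2r ?normal_peak_ge0//.
rewrite -ler_pdivlMr ?expR_gt0// -expRN opprK.
have := expR_ge1Dx (x ^+ 2 / 2 : R); set e := expR _; have := sqr_ge0 x.
by lra.
Qed.

(** Comparison with the wider normal density of standard deviation 2. The function 1 + x^2 then
    serves as the majorant for later integrability claims. *)
Lemma integrable_normal_prob_sqr :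
  gauss.-integrable setT (EFin \o (fun x : R => 1 + x ^+ 2)).
Proof.
have mf : measurable_fun [set: R] (fun x : R => 1 + x ^+ 2).
  by apply: measurable_funD => //; exact: measurable_funX.
apply/(integrable_density (p := phi) (mu := mu)) => //.
- exact: measurable_normal_pdf.
- exact: normal_pdf_ge0.
(* The quotient of peaks exchanges the normalizing constants. The exponents differ by 1/2 - 1/8 =
   3/8, and the factor 4 gives 1 + x^2 <= 4 e^(3 x^2 / 8). *)
pose c : R := 4 * normal_peak 1 / normal_peak 2.
apply: (@le_integrable _ _ _ mu _ _ _ (fun x => c%:E * (normal_pdf 0 2 x)%:E)%E) => //.
- apply/measurable_EFinP/measurable_funM => //; exact: measurable_normal_pdf.
- move=> x _; have x0 : 0 <= 1 + x ^+ 2 by rewrite addr_ge0// sqr_ge0.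
  have c0 : 0 <= c by rewrite !mulr_ge0 ?invr_ge0 ?normal_peak_ge0.
  rewrite -EFinM !abse_EFin lee_fin !ger0_norm; last 2 first.
    exact: mulr_ge0 c0 (normal_pdf_ge0 _ _ _).
    exact: mulr_ge0 x0 (normal_pdf_ge0 _ _ _).
  rewrite std_normal_pdfE normal_pdfE// /c /normal_fun subr0.
  rewrite [leRHS]mulrA divfK ?gt_eqF ?normal_peak_gt0// mulrCA -(mulrA 4).
  rewrite [leRHS]mulrCA.
  rewrite ler_wpM2l ?normal_peak_ge0//.
  have -> : - x ^+ 2 / (2 ^+ 2 *+ 2) = 3 / 8 * x ^+ 2 + (- (x ^+ 2 / 2)) :> R.
    by rewrite -mulr_natr; field.
  rewrite expRD mulrA ler_wpM2r ?expR_ge0//.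
  have := expR_ge1Dx (3 / 8 * x ^+ 2 : R); set e := expR _; have := sqr_ge0 x.
  by lra.
- by apply: integrableZl => //; exact: integrable_normal_pdf.
Qed.


(** Boundary terms of the integration by parts, with [u n] equal to n or -n. As (1 + n)^2 <= 2 (1 +
    n^2), the bound on (1 + x^2) phi(x) makes the product O(1 / (n + 1)). *)
Lemma std_normal_pdf_cvg0 (u : nat -> R) (f : R -> R) (C : R) :
  (forall n, `|u n| = n%:R) -> (forall x, `|f x| <= C * (1 + `|x|)) ->
  f (u n) * phi (u n) @[n --> \oo] --> (0 : R).
Proof.
move=> uE fC; pose K := 4 * C * normal_peak 1.
have C0 : 0 <= C.
  by have := le_trans (normr_ge0 _) (fC 0); rewrite normr0 addr0 mulr1.
apply/norm_cvg0P.
apply: (@squeeze_cvgr _ _ _ _ (cst 0) (fun n => K * n.+1%:R^-1)).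
- apply: nearW => n; rewrite normr_ge0/= normrM (ger0_norm (normal_pdf_ge0 _ _ _)).
  rewrite ler_pdivlMr ?ltr0n//.
  have := std_normal_pdf_sqr_ub (u n); rewrite -(real_normK (num_real (u n))) uE.
  have := fC (u n); rewrite uE.
  have := normal_pdf_ge0 0 1 (u n); set p := phi _; set a := `|f _|.
  move=> p0 aC pK; rewrite -[n.+1%:R]natr1; set x : R := n%:R in aC pK *.
  have x0 : 0 <= x by exact: ler0n.
  have a0 : 0 <= a by exact: normr_ge0.
  apply: (@le_trans _ _ (C * (1 + x) * p * (x + 1))).
    by rewrite ler_wpM2r ?addr_ge0// ler_wpM2r.
  apply: (@le_trans _ _ (C * (2 * ((1 + x ^+ 2) * p)))); last first.
    have -> : K = C * (2 * (2 * normal_peak 1)) by rewrite /K; ring.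
    by rewrite ler_wpM2l// ler_wpM2l.
  have -> : C * (1 + x) * p * (x + 1) = C * ((1 + x) ^+ 2 * p) by ring.
  rewrite ler_wpM2l// mulrA ler_wpM2r//.
  by have := sqr_ge0 (x - 1); nra.
- exact: cvg_cst.
- rewrite -[X in _ --> X](mulr0 K); apply: cvgMr; exact: cvg_harmonic.
Qed.

(** Since phi' = - x phi, the derivative of f phi is (f' - x f) phi, whose integral is 0 because f
    phi vanishes at infinity. *)
Lemma gauss_stein (f f' : R -> R) (C : R) :
  (forall x, is_derive x (1 : R) f (f' x)) -> continuous f' ->
  (forall x, `|f x| <= C * (1 + `|x|)) -> (forall x, `|f' x| <= C) ->
  (\int[gauss]_x (f x * x)%:E = \int[gauss]_x (f' x)%:E)%E.
Proof.
move=> df cf' fC f'C.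
have C0 : 0 <= C by exact: le_trans (normr_ge0 _) (f'C 0).
have cf : continuous f by exact: is_derive_continuous df.
have mf : measurable_fun [set: R] f by exact: continuous_measurable_fun.
have mf' : measurable_fun [set: R] f' by exact: continuous_measurable_fun.
(* A common majorant: |f'| <= C, and |f x| |x| <= C (1 + |x|) |x| <= 2 C (1 + x^2). *)
have i1 : gauss.-integrable setT (EFin \o (fun x => 2 * C * (1 + x ^+ 2))).
  exact: (integrableZl measurableT (2 * C) integrable_normal_prob_sqr).
have if' : gauss.-integrable setT (EFin \o f').
  apply: le_integrable i1 => //; first exact/measurable_EFinP.
  move=> x _; rewrite lee_fin/= [leRHS]ger0_norm; last first.
    by rewrite !mulr_ge0// addr_ge0// sqr_ge0.
  by have := f'C x; have := sqr_ge0 x; nra.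
have ifx : gauss.-integrable setT (EFin \o (fun x => f x * x)).
  apply: le_integrable i1 => //.
    by apply/measurable_EFinP/measurable_funM.
  move=> x _; rewrite lee_fin/= [leRHS]ger0_norm; last first.
    by rewrite !mulr_ge0// addr_ge0// sqr_ge0.
  rewrite normrM -(@real_normK _ x) ?num_real//.
  apply: (@le_trans _ _ (C * (1 + `|x|) * `|x|)); first by rewrite ler_wpM2r.
  rewrite (mulrC 2) -!mulrA ler_wpM2l//.
  by have := sqr_ge0 (`|x| - 1); have := normr_ge0 x; nra.
suff : (\int[gauss]_x (f' x)%:E - \int[gauss]_x (f x * x)%:E = 0)%E.
  have /fineK <- := integrable_fin_num measurableT if'.
  have /fineK <- := integrable_fin_num measurableT ifx.
  by rewrite -EFinB => -[] /subr0_eq ->.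
rewrite -integralB_EFin//.
pose g x := f' x - f x * x.
have mg : measurable_fun [set: R] g.
  by apply: measurable_funB => //; exact: measurable_funM.
have ig : gauss.-integrable setT (EFin \o g) by exact: (integrableB measurableT if' ifx).
rewrite -[LHS]/(\int[gauss]_x (g x)%:E)%E (integral_normal_prob 0 1 mg).
apply: (@integral_derive_eq0 _ (fun x => f x * phi x)).
- move=> x; have := is_derive_std_normal_pdf x => dphi.
  apply: is_derive_eq; rewrite /GRing.scale/= /g; ring.
- move=> x; apply: cvgM; last by apply: continuous_normal_pdf; rewrite oner_eq0.
  apply: cvgB; first exact: cf'.
  by apply: cvgM; [exact: cf|exact: cvg_id].
- apply/(integrable_density (nu := gauss) (p := phi) (mu := mu)) => //.
  + exact: measurable_normal_pdf.
  + exact: normal_pdf_ge0.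
- by apply: std_normal_pdf_cvg0 fC => n; rewrite normr_nat.
- by apply: std_normal_pdf_cvg0 fC => n; rewrite normrN normr_nat.
Qed.
End gauss.

(** * Normal random variables: moments and the one-variable Stein identity *)

Section normal_variables.
Context d (T : measurableType d) (R : realType) (P : probability T R).
Local Notation gauss := (normal_prob (0 : R) 1).

Lemma integrable_gauss_id : gauss.-integrable setT (EFin \o (fun x : R => x)).
Proof.
apply: le_integrable (integrable_normal_prob_sqr R) => //.
  by apply/measurable_EFinP.
move=> x _; rewrite lee_fin/= [leRHS]ger0_norm; last by rewrite addr_ge0// sqr_ge0.
rewrite -(@real_normK _ x) ?num_real//.
by have := sqr_ge0 (`|x| - 1); have := normr_ge0 x; nra.
Qed.

(** Stein's identity for the constant function 1. *)
Lemma integral_gauss_id : (\int[gauss]_x x%:E = 0)%E.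
Proof.
transitivity (\int[gauss]_x (cst 1 x * x)%:E)%E.
  by apply: eq_integral => x _; rewrite /= mul1r.
rewrite (@gauss_stein R (cst 1) (cst 0) 1).
- by rewrite integral0_eq.
- by move=> x; exact: cvg_cst.
- by move=> x; rewrite mul1r normr1 lerDl.
- by move=> x; rewrite normr0.
Qed.

(** Stein's identity for the identity function. *)
Lemma integral_gauss_sqr : (\int[gauss]_x (x * x)%:E = 1)%E.
Proof.
rewrite (@gauss_stein R id (cst 1) 1).
- transitivity (\int[gauss]_x (cst 1 x))%E; first exact: eq_integral.
  by rewrite integral_cst//= [X in (_ * X)%E]probability_setT mule1.
- by move=> x; exact: cvg_cst.
- by move=> x; rewrite mul1r lerDr.
- by move=> x; rewrite normr1.
Qed.

Lemma normal_law_expectation (X : {RV P >-> R}) (m v : R) : 0 <= v ->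
  (forall A : set R, measurable A -> P (X @^-1` A) = normal_law m v A) ->
  ('E_P[X] = m%:E)%E.
Proof.
move=> v0 lawX; rewrite unlock.
rewrite (integral_normal_law v0 lawX (f := id)); last by move=> x; exact: cvg_id.
under eq_integral do rewrite /= EFinD EFinM.
rewrite integralD//; last 2 first.
- exact: finite_measure_integrable_cst.
- by apply: integrableZl => //; exact: integrable_gauss_id.
rewrite integral_cst//= [X in (_ * X)%E]probability_setT mule1.
by rewrite integralZl ?integral_gauss_id ?mule0 ?adde0//; exact: integrable_gauss_id.
Qed.

Lemma normal_law_variance (X : {RV P >-> R}) (m v : R) : 0 <= v ->
  (forall A : set R, measurable A -> P (X @^-1` A) = normal_law m v A) ->
  ('V_P[X] = v%:E)%E.
Proof.
move=> v0 lawX; rewrite /variance unlock (normal_law_expectation v0 lawX)/= unlock.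
rewrite (integral_normal_law v0 lawX (f := fun x => (x - m) * (x - m))); last first.
  have cB : continuous (fun x : R => x - m).
    by move=> x; apply: cvgB; [exact: cvg_id|exact: cvg_cst].
  by move=> x; apply: cvgM; exact: cB.
transitivity (\int[gauss]_z (v%:E * (z * z)%:E))%E.
  apply: eq_integral => z _; rewrite -EFinM; congr EFin.
  by rewrite -[in RHS](sqr_sqrtr v0); ring.
rewrite integralZl ?integral_gauss_sqr ?mule1//.
apply: le_integrable (integrable_normal_prob_sqr R) => //.
  by apply/measurable_EFinP; exact: measurable_funM.
move=> x _; rewrite lee_fin/= !ger0_norm ?addr_ge0 ?sqr_ge0// -expr2 ?sqr_ge0//.
by rewrite lerDr.
Qed.

(** [is_normal] hides its parameters behind an existential; the first two moments identify them as
    [m] and [v]. *)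
Lemma integral_is_normal (X : {RV P >-> R}) (m v : R) (f : R -> R) :
  is_normal P X -> ('E_P[X] = m%:E)%E -> ('V_P[X] = v%:E)%E -> continuous f ->
  (\int[P]_w (f (X w))%:E = \int[gauss]_z (f (m + Num.sqrt v * z)%R)%:E)%E.
Proof.
move=> [m' [v' [v'0 lawX]]].
rewrite (normal_law_expectation v'0 lawX) (normal_law_variance v'0 lawX).
by move=> -[<-] -[<-]; exact: integral_normal_law.
Qed.

(** After standardization, [gauss_stein] applies to z |-> u (f (m + u z) - c), where u = sqrt v and
    c is the mean of f(X); its derivative is u^2 f' = v f'. *)
Lemma normal_stein (X : {RV P >-> R}) (m v C : R) (f f' : R -> R) :
  is_normal P X -> ('E_P[X] = m%:E)%E -> ('V_P[X] = v%:E)%E ->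
  (forall x, is_derive x (1 : R) f (f' x)) -> continuous f' ->
  (forall x, `|f x| <= C) -> (forall x, `|f' x| <= C) ->
  (covariance P (f \o X) X =
   \int[gauss]_z (v * f' (m + Num.sqrt v * z))%:E)%E.
Proof.
move=> nX EX VX df cf' fC f'C.
have v0 : 0 <= v by rewrite -lee_fin -VX variance_ge0.
have C0 : 0 <= C by exact: le_trans (normr_ge0 _) (f'C 0).
have cf : continuous f by exact: is_derive_continuous df.
rewrite unlock EX/=; set c := fine _; rewrite unlock.
rewrite (integral_is_normal (f := fun x => (f x - c) * (x - m)) nX EX VX); last first.
  move=> x; apply: cvgM; first by apply: cvgB; [exact: cf|exact: cvg_cst].
  by apply: cvgB; [exact: cvg_id|exact: cvg_cst].
set u := Num.sqrt v; have u0 : 0 <= u by exact: sqrtr_ge0.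
transitivity (\int[gauss]_z (u * (f (m + u * z) - c) * z)%:E)%E.
  by apply: eq_integral => z _; congr EFin; ring.
(* One constant has to serve the function and its derivative, so their bounds u (C + |c|) and v C
   are added. *)
apply: (@gauss_stein _ _ _ (u * (C + `|c|) + v * C)).
- move=> x.
  have dF : is_derive x (1 : R) (f \o (fun z => m + u * z)) (u * f' (m + u * x)).
    have dg : is_derive x (1 : R) (fun z : R => m + u * z) u.
      by apply: is_derive_eq; rewrite /GRing.scale/= add0r mul1r mulr1.
    have dfx := df (m + u * x).
    by apply: is_derive_eq; rewrite /GRing.scale/= mulrC.
  apply: is_derive_eq; rewrite /GRing.scale/= -(sqr_sqrtr v0) -/u; ring.
- move=> x; apply: cvgM; first exact: cvg_cst.
  apply: (@continuous_comp _ _ _ (fun z => m + u * z) f'); last exact: cf'.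
  by apply: cvgD; [exact: cvg_cst|apply: cvgMr; exact: cvg_id].
- move=> x; rewrite normrM (ger0_norm u0).
  have vC : 0 <= v * C by exact: mulr_ge0.
  have K0 : 0 <= u * (C + `|c|) by rewrite mulr_ge0// addr_ge0.
  apply: (@le_trans _ _ (u * (C + `|c|))).
    by rewrite ler_wpM2l// (le_trans (ler_normB _ _))// lerD2r.
  rewrite (@le_trans _ _ (u * (C + `|c|) + v * C)) ?lerDl//.
  by rewrite ler_peMr ?addr_ge0// lerDl.
- move=> x; rewrite normrM (ger0_norm v0).
  apply: (@le_trans _ _ (v * C)); first by rewrite ler_wpM2l.
  by rewrite lerDr mulr_ge0// addr_ge0.
Qed.

End normal_variables.

(** * The probit function and the Gaussian integral of its derivative *)

Section probit.
Context (R : realType).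
Local Notation mu := (@lebesgue_measure R).
Local Notation gauss := (normal_prob (0 : R) 1).
Local Notation phi := (normal_pdf (0 : R) 1).

Lemma is_derive_std_normal_cdf (x : R) :
  is_derive x (1 : R) (@std_normal_cdf R) (phi x).
Proof.
(* Any endpoint beyond [x] would do: it makes [x] interior to the half-line of integration. *)
have xx1 : x < x + 1 by rewrite ltrDl.
have iphi : mu.-integrable [set` Interval -oo%O (BRight (x + 1))] (EFin \o phi).
  by apply: (integrableS measurableT) => //; exact: integrable_normal_pdf.
have cphi : {for x, continuous phi} by apply: continuous_normal_pdf; rewrite oner_eq0.
have [dF F'x] := continuous_FTC1 xx1 iphi (ltNyr x) cphi.
(* Holds by conversion, [normal_prob] being defined as the integral of its density. *)
have E : @std_normal_cdf R =
    (fun y => \int[mu]_(t in [set` Interval -oo%O (BRight y)]) phi t).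
  by [].
by apply: DeriveDef; rewrite E//; rewrite -F'x derive1E.
Qed.

Lemma is_derive_probit (x : R) : is_derive x (1 : R) (@probit R) (2 * phi x).
Proof.
have dc := is_derive_std_normal_cdf x.
by apply: is_derive_eq; rewrite /GRing.scale/=; ring.
Qed.

Lemma probit_le1 (x : R) : `|probit x| <= 1.
Proof.
rewrite /probit /std_normal_cdf; set p := fine _.
have p0 : 0 <= p by exact: fine_ge0.
have le1 : (normal_prob 0%R 1%R `]-oo, x] <= 1 :> \bar R)%E.
  by apply: (@probability_le1 _ _ _ gauss); exact: measurable_itv.
have p1 : p <= 1.
  by rewrite -lee_fin /p fineK// ge0_fin_numE// (le_lt_trans le1)// ltry.
by rewrite ler_norml; apply/andP; split; lra.
Qed.

(** The derivative -2 y phi(y) of 2 phi cancels the term y (2 phi(y)) of the product rule. *)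
Lemma is_derive_probit_primitive (x : R) :
  is_derive x (1 : R) (fun y : R => y * probit y + 2 * phi y) (probit x).
Proof.
have dp := is_derive_probit x.
have dphi := is_derive_std_normal_pdf x.
by apply: is_derive_eq; rewrite /GRing.scale/=; ring.
Qed.

(** Completing the square: (m + u z)^2 + z^2 = (s z + m u / s)^2 + m^2 / s^2. *)
Lemma std_normal_pdf_mul (m u z : R) : let s := Num.sqrt (1 + u ^+ 2) in
  phi (m + u * z) * phi z = phi (m / s) * phi (s * z + m * u / s).
Proof.
move=> s; have s0 : 0 < s by rewrite sqrtr_gt0 ltr_pwDl// sqr_ge0.
have sE : s ^+ 2 = 1 + u ^+ 2 by rewrite sqr_sqrtr// addr_ge0// sqr_ge0.
rewrite !std_normal_pdfE mulrACA -expRD [RHS]mulrACA -expRD.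
congr (_ * expR _); rewrite -!opprD -!mulrDl; congr (- (_ / _)).
have -> : (s * z + m * u / s) ^+ 2 =
    s ^+ 2 * z ^+ 2 + 2 * m * u * z + (m * u) ^+ 2 / s ^+ 2.
  by field; rewrite gt_eqF.
rewrite expr_div_n sE.
by field; rewrite -sE expf_neq0// gt_eqF.
Qed.

Lemma integral_gauss_std_normal_pdf (m u : R) : let s := Num.sqrt (1 + u ^+ 2) in
  (\int[gauss]_z (phi (m + u * z))%:E = (phi (m / s) / s)%:E)%E.
Proof.
move=> s; have s0 : 0 < s by rewrite sqrtr_gt0 ltr_pwDl// sqr_ge0.
have mphi : measurable_fun [set: R] (fun z => phi (m + u * z)).
  apply: (@measurableT_comp _ _ _ _ _ _ phi).
    exact: measurable_normal_pdf.
  by apply: measurable_funD => //; exact: measurable_funM.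
rewrite (integral_normal_prob 0 1 mphi).
(* The zero of s z + m u / s: as a function of z, the second Gaussian factor is 1/s times the normal
   density of mean [m'] and standard deviation 1/s. *)
pose m' := - (m * u / s ^+ 2).
transitivity (\int[mu]_z ((phi (m / s) / s)%:E * (normal_pdf m' s^-1 z)%:E))%E.
  apply: eq_integral => z _; rewrite -EFinM std_normal_pdf_mul -/s.
  congr EFin; rewrite -[RHS]mulrA; congr (_ * _).
  have := @normal_pdf_affine R m' s^-1 (s * z + m * u / s).
  rewrite invr_gt0 => /(_ s0) <-.
  rewrite mulrC; congr (_ * normal_pdf _ _ _).
  by rewrite /m'; field; rewrite gt_eqF.
rewrite integralZl//; last exact: integrable_normal_pdf.
by rewrite integral_normal_pdf mule1.
Qed.

End probit.

(** * Uncorrelated jointly normal variables *)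

Section uncorrelated.
Context d (T : measurableType d) (R : realType) (P : probability T R).
Local Notation gauss := (normal_prob (0 : R) 1).

(** X - m is square integrable since its squared L2 norm is the variance, and constants lie in L2.
    [fine] makes [m] a real number even before the mean is known to be finite. *)
Lemma variance_Lfun2 (X : {RV P >-> R}) (v : R) :
  ('V_P[X] = v%:E)%E -> (X : T -> R) \in Lfun P 2%:E.
Proof.
rewrite /variance unlock; set m := fine _ => VX.
have mXm : measurable_fun setT (X \- cst m) by exact: measurable_funB.
have Xm2 : (X \- cst m) \in Lfun P 2%:E.
  rewrite inE; apply/andP; split; rewrite inE//=.
  rewrite /finite_norm unlock /Lnorm/= poweR_lty//.
  move: VX; rewrite unlock => VX.
  rewrite [ltLHS](_ : _ = v%:E) ?ltry// -VX; apply: eq_integral => w _.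
  by congr EFin; rewrite powR_mulrn// real_normK ?num_real//.
have -> : (X : T -> R) = (X \- cst m) \+ cst m.
  by apply/funext => w /=; rewrite subrK.
by rewrite rpredD ?lee1n//= => _; exact: Lfun_cst.
Qed.

Lemma bounded_Lfun2 (f : T -> R) (C : R) : measurable_fun setT f ->
  (forall w, `|f w| <= C) -> f \in Lfun P 2%:E.
Proof.
move=> mf fC; rewrite inE; apply/andP; split; rewrite inE//=.
rewrite /finite_norm unlock /Lnorm/= poweR_lty//.
have : P.-integrable setT (EFin \o (fun w => f w ^+ 2)).
  have icst : P.-integrable setT (EFin \o cst (C ^+ 2)).
    exact: finite_measure_integrable_cst.
  apply: le_integrable icst => //.
    by apply/measurable_EFinP; exact: measurable_funX.
  move=> w _; rewrite lee_fin/= !ger0_norm ?sqr_ge0//.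
  by rewrite -[leLHS]real_normK ?num_real// lerXn2r// nnegrE (le_trans _ (fC w)).
move=> /integrableP[_]; apply: le_lt_trans.
rewrite le_eqVlt; apply/orP; left; apply/eqP; apply: eq_integral => w _.
by rewrite /= powR_mulrn// normrX.
Qed.

(** The mean value theorem between x - t and x + t; a negative t swaps the endpoints and changes
    both signs. It gives Lipschitz bounds and controls symmetric difference quotients. *)
Lemma symmetric_MVT (G f : R -> R) (x t : R) :
  (forall y, is_derive y (1 : R) G (f y)) ->
  exists2 c, `|c - x| <= `|t| & G (x + t) - G (x - t) = f c * (2 * t).
Proof.
move=> dG.
have cG : continuous G by exact: is_derive_continuous dG.
have pos (s : R) : 0 <= s ->
    exists2 c, `|c - x| <= s & G (x + s) - G (x - s) = f c * (2 * s).
  move=> s0; have xs : x - s <= x + s by lra.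
  have cGxs : {within `[x - s, x + s], continuous G} by exact: continuous_subspaceT.
  have [c] := MVT_segment xs (fun y _ => dG y) cGxs.
  rewrite in_itv/= => /andP[c1 c2 E]; exists c.
    by rewrite ler_norml; apply/andP; split; lra.
  by rewrite E; congr (_ * _); ring.
have [t0|t0] := leP 0 t; first by rewrite ger0_norm//; exact: pos.
have [|c ct E] := pos (- t); first by rewrite oppr_ge0 ltW.
exists c; first by rewrite (ltr0_norm t0).
by move: E; rewrite opprK => E; rewrite -opprB E; ring.
Qed.

(** The derivative at b = 0 is taken along symmetric difference quotients of step 1/(k+1): each has
    integral 0, and M |Z| dominates them, so the limit passes under the integral. *)
Lemma jointly_normal_uncorrelated (X Y : {RV P >-> R}) (G f : R -> R) (M : R) :
  jointly_normal X Y ->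
  (X : T -> R) \in Lfun P 2%:E -> (Y : T -> R) \in Lfun P 2%:E ->
  covariance P X Y = 0%E ->
  (forall x, is_derive x (1 : R) G (f x)) -> continuous f ->
  (forall x, `|f x| <= M) ->
  covariance P (f \o X) Y = 0%E.
Proof.
move=> nXY X2 Y2 cXY dG cf fM.
have Pfin : P setT \is a fin_num := fin_num_measure P _ measurableT.
have X1 := Lfun_subset12 Pfin X2; have Y1 := Lfun_subset12 Pfin Y2.
have iX := (Lfun1_integrable _ _).1 X1; have iY := (Lfun1_integrable _ _).1 Y1.
have cG : continuous G by exact: is_derive_continuous dG.
pose m := fine 'E_P[X]%E; pose n := fine 'E_P[Y]%E.
have EX : ('E_P[X] = m%:E)%E by rewrite fineK// expectation_fin_num.
have EY : ('E_P[Y] = n%:E)%E by rewrite fineK// expectation_fin_num.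
pose Z w := Y w - n.
have icst (c : R) : P.-integrable setT (EFin \o cst c).
  exact: finite_measure_integrable_cst.
have mZ : measurable_fun setT Z by exact: measurable_funB.
have mG : measurable_fun setT G by exact: continuous_measurable_fun.
have mf : measurable_fun setT f by exact: continuous_measurable_fun.
have iZ : P.-integrable setT (EFin \o Z).
  exact: (integrableB measurableT iY (icst n)).
have EZ : (\int[P]_w (Z w)%:E = 0)%E.
  rewrite -[LHS]/(\int[P]_w ((Y w)%:E - (cst n w)%:E))%E integralB_EFin//.
  have := expectation_cst P n; rewrite unlock => ->.
  by move: EY; rewrite unlock => ->; rewrite subee.
have mW b : measurable_fun setT (fun w => X w + b * Z w).
  by apply: measurable_funD => //; exact: measurable_funM.
have iW b : P.-integrable setT (EFin \o (fun w => X w + b * Z w)).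
  exact: (integrableD measurableT iX (integrableZl measurableT b iZ)).
have M0 : 0 <= M by exact: le_trans (normr_ge0 _) (fM 0).
(* [G] is M-Lipschitz, by the symmetric mean value theorem about the midpoint of x and y; hence it
   grows at most linearly and is integrable along X + b Z. *)
have G_le x y : `|G x - G y| <= M * `|x - y|.
  have [c _ E] := symmetric_MVT ((x + y) / 2) ((x - y) / 2) dG.
  have -> : G x - G y = f c * (x - y).
    rewrite (_ : x - y = 2 * ((x - y) / 2)); last by field.
    by rewrite -E; congr (G _ - G _); field.
  by rewrite normrM ler_wpM2r.
have iG b : P.-integrable setT (EFin \o (fun w => G (X w + b * Z w))).
  have i1 : P.-integrable setT
      (EFin \o (fun w => `|G 0| + M * `|X w + b * Z w|)).
    have := integrableZl measurableT M (integrable_norm (iW b)).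
    exact: (integrableD measurableT (icst `|G 0|)).
  apply: le_integrable i1 => //.
    by apply/measurable_EFinP; exact: measurableT_comp.
  move=> w _; rewrite lee_fin/= [leRHS]ger0_norm ?addr_ge0 ?mulr_ge0//.
  have := G_le (X w + b * Z w) 0; rewrite subr0 => GM.
  rewrite -[X in `|X| <= _](subrK (G 0)) addrC.
  by rewrite (le_trans (ler_normD _ _))// lerD2l.
(* The right-hand side depends on [b] only through b^2, because Z is centred and uncorrelated with
   X. *)
have GE b : (\int[P]_w (G (X w + b * Z w))%:E = \int[gauss]_z
    (G (m + Num.sqrt (fine 'V_P[X]%E + b ^+ 2 * fine 'V_P[Y]%E) * z))%:E)%E.
  have mV : measurable_fun setT (fun w => 1 * X w + b * Y w).
    by apply: measurable_funD; exact: measurable_funM.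
  pose V : {RV P >-> R} := mfun_Sub (mem_set mV).
  have VE : (V : T -> R) = X \+ b \o* Y.
    by apply/funext => w /=; rewrite mul1r mulrC.
  have bY2 : b \o* Y \in Lfun P 2%:E by rewrite Lfun_scale// ler1n.
  have EV : ('E_P[V] = (m + b * n)%:E)%E.
    by rewrite VE expectationD ?expectationZl ?EX ?EY// Lfun_scale.
  have VV : ('V_P[V] = (fine 'V_P[X]%E + b ^+ 2 * fine 'V_P[Y]%E)%:E)%E.
    rewrite VE varianceD// varianceZ// covarianceZr ?Lfun2_mul_Lfun1//.
    rewrite cXY !mule0 adde0.
    have /fineK {1}<- := variance_fin_num X2.
    by have /fineK {1}<- := variance_fin_num Y2.
  have nV : is_normal P V := nXY 1 b.
  (* X + b Z is V - b n, so the centring shift is moved into the test function. *)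
  have := integral_is_normal (f := fun x => G (x - b * n)) nV EV VV.
  rewrite (_ : (\int[P]_w _)%E = \int[P]_w (G (X w + b * Z w))%:E)%E; last first.
    by apply: eq_integral => w _; congr (G _)%:E; rewrite /Z /=; ring.
  move=> ->; last first.
    move=> x; apply: (@continuous_comp _ _ _ (fun x => x - b * n) G); last exact: cG.
    by apply: cvgB; [exact: cvg_id|exact: cvg_cst].
  by apply: eq_integral => z _; congr (G _)%:E; ring.
pose e (k : nat) : R := k.+1%:R^-1.
have e0 k : 0 < e k by rewrite invr_gt0 ltr0n.
pose D (k : nat) w := (G (X w + e k * Z w) - G (X w - e k * Z w)) * (2 * e k)^-1.
have D0 k : (\int[P]_w (D k w)%:E = 0)%E.
  have iB : P.-integrable setT (EFin \o (fun w =>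
      G (X w + e k * Z w) - G (X w + - e k * Z w))).
    exact: (integrableB measurableT (iG _) (iG _)).
  transitivity (\int[P]_w ((2 * e k)^-1%:E *
      (G (X w + e k * Z w) - G (X w + - e k * Z w))%:E))%E.
    by apply: eq_integral => w _; rewrite -EFinM /D mulNr mulrC.
  rewrite (integralZl measurableT iB) (integralB_EFin measurableT (iG _) (iG _)).
  have := integrable_fin_num measurableT (iG (e k)).
  by rewrite !GE sqrrN => /subee ->; rewrite mule0.
(* The quotient is f(c) Z with c within e_k |Z| of X, which provides both the pointwise limit f(X) Z
   and the majorant. *)
have DE k w : exists2 c, `|c - X w| <= `|e k * Z w| & D k w = f c * Z w.
  have [c cX E] := symmetric_MVT (X w) (e k * Z w) dG.
  by exists c => //; rewrite /D E; field; rewrite gt_eqF.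
have mD k : measurable_fun setT (D k).
  apply: measurable_funM => //; apply: measurable_funB.
    by apply: measurableT_comp => //; exact: mW.
  apply: measurableT_comp => //; apply: measurable_funB => //.
  exact: measurable_funM.
have D_cvg w : D k w @[k --> \oo] --> f (X w) * Z w.
  have /choice[c Hc] : forall k, exists c,
      `|c - X w| <= `|e k * Z w| /\ D k w = f c * Z w.
    by move=> k; have [c] := DE k w; exists c.
  rewrite (_ : (fun k => D k w) = (fun k => f (c k) * Z w)); last first.
    by apply/funext => k; have [] := Hc k.
  apply: cvgMl; apply: (cvg_comp c f); last exact: cf.
  apply/subr_cvg0/norm_cvg0P.
  apply: (@squeeze_cvgr _ _ _ _ (cst 0) (fun k => `|Z w| * e k)).
  - apply: nearW => k; rewrite normr_ge0/=; have [+ _] := Hc k.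
    by rewrite normrM (gtr0_norm (e0 k)) mulrC.
  - exact: cvg_cst.
  - by rewrite -[X in _ --> X](mulr0 `|Z w|); apply: cvgMr; exact: cvg_harmonic.
have [iF _] : [/\ P.-integrable setT (EFin \o (fun w => f (X w) * Z w)%R),
   [sequence \int[P]_w `|(D k w)%:E
      - (EFin \o (fun w => f (X w) * Z w)%R) w|]_k @ \oo --> 0 &
   [sequence \int[P]_w (D k w)%:E]_k @ \oo -->
      \int[P]_w ((EFin \o (fun w => f (X w) * Z w)%R) w)]%E.
  apply: (@dominated_convergence _ _ _ P setT measurableT (fun k w => (D k w)%:E) _
    (fun w => (M * `|Z w|)%:E)) => //.
  - by move=> k; exact/measurable_EFinP.
  - apply/measurable_EFinP/measurable_funM => //.
    exact: measurableT_comp.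
  - by apply: aeW => w _; apply: cvg_EFin; [exact: nearW|exact: D_cvg].
  - exact: (integrableZl measurableT M (integrable_norm iZ)).
  - apply: aeW => w k _; have [c _ ->] := DE k w.
    by rewrite abse_EFin lee_fin normrM ler_wpM2r.
rewrite [X in X @ _ --> _](_ : _ = cst 0%E); last by apply/funext => k; exact: D0.
move=> /(cvg_unique (@ereal_hausdorff R) (cvg_cst _)) fZ0.
(* The mean [c] of f(X) only multiplies Z, whose integral is 0. *)
rewrite unlock -/n; set c := fine _; rewrite unlock.
transitivity (\int[P]_w ((f (X w) * Z w)%:E - (c * Z w)%:E))%E.
  apply: eq_integral => w _; rewrite -EFinB /Z.
  by rewrite -[LHS]/((f (X w) - c) * (Y w - n))%:E; congr EFin; ring.
rewrite (integralB_EFin measurableT iF (integrableZl measurableT c iZ)) -fZ0.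
under eq_integral do rewrite EFinM.
by rewrite (integralZl measurableT iZ) EZ mule0 subee.
Qed.

End uncorrelated.

(** * Regression of [X2] on [X1] and the probit covariance *)

Theorem lemmaC3 (R : realType) (mu1 nu11 nu22 nu12 : R)
    (psd : psdmx (covmx2 nu11 nu22 nu12))
    (d : measure_display) (T : measurableType d) (P : probability T R)
    (X1 X2 : {RV P >-> R})
    (normalX : jointly_normal X1 X2)
    (meanX1 : ('E_P[X1] = mu1%:E)%E)
    (varX1 : ('V_P[X1] = nu11%:E)%E)
    (varX2 : ('V_P[X2] = nu22%:E)%E)
    (covX : covariance P X1 X2 = nu12%:E) :
  covariance P (fun w => probit (X1 w)) X2 =
    (2 * nu12 / Num.sqrt (1 + nu11)
       * std_normal_pdf (mu1 / Num.sqrt (1 + nu11)))%:E.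
Proof.
have X12 := variance_Lfun2 varX1; have X22 := variance_Lfun2 varX2.
have nu11_ge0 : 0 <= nu11 by rewrite -lee_fin -varX1 variance_ge0.
have cprobit : continuous (@probit R).
  exact: is_derive_continuous (@is_derive_probit R).
(* If [nu11 = 0] then [c = 0], which is still the right coefficient since
   [nu12 = 0] by Cauchy-Schwarz. *)
pose c := nu12 / nu11.
have cnu11 : c * nu11 = nu12.
  have [nu11_0|nu11_neq0] := eqVneq nu11 0; last by rewrite divfK.
  have cov_le0 (Z : T -> R) : Z \in Lfun P 2%:E -> (covariance P X1 Z <= 0)%E.
    by move=> /(covariance_le X12); rewrite varX1 nu11_0 /= sqrtr0 mul0e.
  have X11 : (X1 : T -> R) \in Lfun P 1.
    by apply: Lfun_subset12 X12; exact: fin_num_measure.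
  have X21 : (X2 : T -> R) \in Lfun P 1.
    by apply: Lfun_subset12 X22; exact: fin_num_measure.
  (* The bound is one-sided; using it for X2 and for -X2 forces nu12 = 0. *)
  have := cov_le0 _ X22; have := cov_le0 (\- X2)%R.
  rewrite rpredN covarianceNr ?Lfun2_mul_Lfun1// covX -EFinN !lee_fin => /(_ X22).
  by rewrite nu11_0 mulr0; lra.
have cX12 : c \o* X1 \in Lfun P 2%:E by rewrite Lfun_scale// ler1n.
have mY : measurable_fun setT (X2 \- c \o* X1).
  by apply: measurable_funB => //; exact: measurable_funM.
(* The regression residual: every linear combination of X1 and Y is one of X1 and X2, and c nu11 =
   nu12 makes Y uncorrelated with X1. *)
pose Y : {RV P >-> R} := mfun_Sub (mem_set mY).
have YE : (Y : T -> R) = X2 \- c \o* X1 by [].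
have Y2 : (Y : T -> R) \in Lfun P 2%:E by rewrite YE rpredB ?lee1n.
have normalY : jointly_normal X1 Y.
  move=> a b; have := normalX (a - b * c) b.
  rewrite (_ : (fun w => (a - b * c) * X1 w + b * X2 w) =
               (fun w => a * X1 w + b * Y w))//.
  by apply/funext => w; rewrite YE/=; ring.
have covY : covariance P X1 Y = 0%E.
  rewrite YE covarianceBr// covarianceZr ?Lfun2_mul_Lfun1//; last 2 first.
  - by apply: Lfun_subset12 X12; exact: fin_num_measure.
  - by apply: Lfun_subset12 X12; exact: fin_num_measure.
  by rewrite covX -[covariance P X1 X1]/('V_P[X1])%E varX1 -EFinM cnu11 subee.
have covprobitY := jointly_normal_uncorrelated normalY X12 Y2 covY
  (@is_derive_probit_primitive R) cprobit (@probit_le1 R).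
have probit2 : (@probit R \o X1) \in Lfun P 2%:E.
  apply: (@bounded_Lfun2 _ _ _ _ _ 1) => [|w]; last exact: probit_le1.
  by apply: measurableT_comp => //; exact: continuous_measurable_fun.
have -> : (X2 : T -> R) = c \o* X1 \+ Y.
  by apply/funext => w; rewrite YE /= subrKC.
rewrite -[X in covariance P X _]/(@probit R \o X1) covarianceDr// covprobitY adde0.
rewrite covarianceZr ?Lfun2_mul_Lfun1//; last 2 first.
- by apply: Lfun_subset12 probit2; exact: fin_num_measure.
- by apply: Lfun_subset12 X12; exact: fin_num_measure.
have cphi : continuous (fun x : R => 2 * normal_pdf 0 1 x).
  move=> x; apply: cvgMr; apply: continuous_normal_pdf; exact: oner_neq0.
(* Dominates both the bound 1 on probit and the bound on its derivative 2 phi. *)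
pose C : R := 1 + 2 * normal_peak 1.
have C1 : 1 <= C by rewrite lerDl mulr_ge0// normal_peak_ge0.
have normalX1 : is_normal P X1.
  have := normalX 1 0; rewrite (_ : (fun w => _) = X1)//.
  by apply/funext => w; rewrite mul1r mul0r addr0.
rewrite (normal_stein (C := C) normalX1 meanX1 varX1 (@is_derive_probit R) cphi).
- transitivity (c%:E * \int[normal_prob (0 : R) 1]_z
      ((nu11 * 2)%:E * (normal_pdf 0 1 (mu1 + Num.sqrt nu11 * z))%:E))%E.
    by congr (_ * _)%E; apply: eq_integral => z _; rewrite -EFinM mulrA.
  have cphiX : continuous (fun z : R => normal_pdf 0 1 (mu1 + Num.sqrt nu11 * z)).
    move=> z; apply: (@continuous_comp _ _ _ (fun z => mu1 + Num.sqrt nu11 * z)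
      (normal_pdf 0 1)); last by apply: continuous_normal_pdf; exact: oner_neq0.
    by apply: cvgD; [exact: cvg_cst|apply: cvgMr; exact: cvg_id].
  rewrite integralZl//; last first.
    have icst : (normal_prob (0 : R) 1).-integrable setT (EFin \o cst (normal_peak 1)).
      exact: finite_measure_integrable_cst.
    apply: le_integrable icst => //.
      apply/measurable_EFinP.
      exact: (continuous_measurable_fun cphiX : measurable_fun [set: R] _).
    move=> z _; rewrite lee_fin/= !ger0_norm ?normal_peak_ge0 ?normal_pdf_ge0//.
    by rewrite normal_pdf_ub// oner_neq0.
  (* With u = sqrt nu11 the scale s becomes sqrt (1 + nu11); the prefactor c nu11 is then nu12. *)
  have := integral_gauss_std_normal_pdf mu1 (Num.sqrt nu11); rewrite sqr_sqrtr// => ->.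
  rewrite -!EFinM /std_normal_pdf; congr EFin; rewrite -cnu11; field.
  by rewrite gt_eqF// sqrtr_gt0 ltr_pwDl.
- by move=> x; apply: le_trans C1; exact: probit_le1.
- move=> x; rewrite ger0_norm ?mulr_ge0 ?normal_pdf_ge0//.
  apply: (@le_trans _ _ (2 * normal_peak 1)); last by rewrite lerDr.
  by rewrite ler_wpM2l// normal_pdf_ub// oner_neq0.
Qed.
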